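(* For all $f,g,h\in\mathcal{A}$, $$3\,\mathrm{area}(h, f ⧢ g) = f ⧢ \mathrm{area}(h,g) + g ⧢ \mathrm{area}(h,f) - f ⧢ g ⧢ h + \langle f,e\rangle\langle g,e\rangle\langle h,e\rangle\, e + \mathrm{area}(\mathrm{area}(h,g),f) + \mathrm{area}(\mathrm{area}(h,f),g).$$
   Context: Let $A$ be a finite alphabet, $W_A$ the set of all words over $A$ including the empty word $e$, and $\mathcal{A}$ the real vector space with basis $W_A$. For $f\in\mathcal{A}$, $\langle f,e\rangle$ denotes the coefficient of $e$ in $f$. Juxtaposition denotes concatenation of words, extended bilinearly. The (left) half shuffle $\prec:\mathcal{A}\times\mathcal{A}\to\mathcal{A}$ is the bilinear map determined on words by: $e\prec w=0$ for every word $w$ (including $w=e$); $u\prec e=u$ for every non-empty word $u$; $a\prec w=aw$ for every letter $a$ and word $w$; and recursively $(au)\prec w=a(u\prec w+w\prec u)$ for every letter $a$, non-empty word $u$ and word $w$. The shuffle product is $f ⧢ g = f\prec g+g\prec f+\langle f,e\rangle\langle g,e\rangle e$; it is associative and commutative. The operator $\mathrm{area}:\mathcal{A}\times\mathcal{A}\to\mathcal{A}$ is $\mathrm{area}(f,g)=f\prec g-g\prec f$. *)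

(* Defs.v *)
From mathcomp Require Import all_boot all_order all_algebra.
From mathcomp Require Import finmap.
From mathcomp Require Import monalg.
From mathcomp Require Import reals.

Set Implicit Arguments.
Unset Strict Implicit.
Unset Printing Implicit Defensive.

Import GRing.Theory.
Local Open Scope ring_scope.

(* W_A is the free monoid {fmonom A}, with e = mone (the empty word), and the vector space with
   basis W_A is the free monoid algebra {malg R[{fmonom A}]}.  Its ring product
   is the bilinear extension of concatenation, its unit 1 is << e >>, and f@_e
   is the coefficient of e in f. *)
Notation tensor_alg R A := {malg R[{fmonom A}]}.

Reserved Notation "f ≺ g" (at level 40, left associativity).
Reserved Notation "f ⧢ g" (at level 40, left associativity).

Section HalfShuffle.

Variables (R : comNzRingType) (A : finType).
Implicit Types (u w : {fmonom A}) (f g h : tensor_alg R A).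

Definition letter (a : A) : tensor_alg R A := << fmu a >>.

(* The recursive calls exchange the two arguments but decrease the sum of their
   lengths, which n bounds; see half_shuffle1, half_shufflee,
   half_shuffle_letter and half_shuffle_cons for the resulting equations. *)
Fixpoint half_shuffle_rec (n : nat) (u w : seq A) : tensor_alg R A :=
  if n is n'.+1 then
    match u, w with
    | [::], _ => 0
    | _, [::] => << FMonom u >>
    | [:: a], _ => letter a * << FMonom w >>
    | a :: u', _ =>
        letter a * (half_shuffle_rec n' u' w + half_shuffle_rec n' w u')
    end
  else 0.

Definition half_shuffle_word u w : tensor_alg R A :=
  half_shuffle_rec (size u + size w) u w.

Definition half_shuffle f g : tensor_alg R A :=
  \sum_(u <- msupp f) \sum_(w <- msupp g)
    (f@_u * g@_w) *: half_shuffle_word u w.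

Local Notation "f ≺ g" := (half_shuffle f g) : ring_scope.

Definition shuffle f g : tensor_alg R A :=
  f ≺ g + g ≺ f + (f@_mone * g@_mone) *: 1.

Definition area f g : tensor_alg R A := f ≺ g - g ≺ f.

Lemma letter_mulU a u : letter a * << u >> = << FMonom (a :: u) >>.
Proof. by rewrite malgM_def fgmulUU mulr1 /mmul /= /fmmul /fmu !fmE. Qed.

Lemma half_shuffleEw (d1 d2 : {fset {fmonom A}}) f g :
  (msupp f `<=` d1)%fset -> (msupp g `<=` d2)%fset ->
  f ≺ g = \sum_(u <- d1) \sum_(w <- d2) (f@_u * g@_w) *: half_shuffle_word u w.
Proof.
move=> le1 le2; rewrite /half_shuffle (big_fset_incl _ le1) /=; last first.
  move=> u _ /mcoeff_outdom ->.
  by rewrite big1 // => w _; rewrite mul0r scale0r.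
apply: eq_bigr => u _; rewrite (big_fset_incl _ le2) //=.
by move=> w _ /mcoeff_outdom ->; rewrite mulr0 scale0r.
Qed.

Lemma half_shuffleUU u w : << u >> ≺ << w >> = half_shuffle_word u w.
Proof.
rewrite /half_shuffle !msuppU oner_eq0 !big_seq_fset1 !mcoeffUU.
by rewrite mul1r scale1r.
Qed.

Lemma half_shuffle_linearl c f1 f2 g :
  (c *: f1 + f2) ≺ g = c *: (f1 ≺ g) + f2 ≺ g.
Proof.
pose d := (msupp (c *: f1 + f2) `|` (msupp f1 `|` msupp f2))%fset.
have le0 : (msupp (c *: f1 + f2) `<=` d)%fset by apply: fsubsetUl.
have le1 : (msupp f1 `<=` d)%fset by rewrite /d fsubsetU // fsubsetUl orbT.
have le2 : (msupp f2 `<=` d)%fset by rewrite /d fsubsetU // fsubsetUr orbT.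
have leg := fsubset_refl (msupp g).
rewrite (half_shuffleEw le0 leg) (half_shuffleEw le1 leg).
rewrite (half_shuffleEw le2 leg) scaler_sumr -big_split; apply: eq_bigr => u _.
rewrite scaler_sumr -big_split; apply: eq_bigr => w _ /=.
by rewrite mcoeffD mcoeffZ mulrDl scalerDl -mulrA scalerA.
Qed.

Lemma half_shuffle_linearr c f g1 g2 :
  f ≺ (c *: g1 + g2) = c *: (f ≺ g1) + f ≺ g2.
Proof.
pose d := (msupp (c *: g1 + g2) `|` (msupp g1 `|` msupp g2))%fset.
have le0 : (msupp (c *: g1 + g2) `<=` d)%fset by apply: fsubsetUl.
have le1 : (msupp g1 `<=` d)%fset by rewrite /d fsubsetU // fsubsetUl orbT.
have le2 : (msupp g2 `<=` d)%fset by rewrite /d fsubsetU // fsubsetUr orbT.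
have lef := fsubset_refl (msupp f).
rewrite (half_shuffleEw lef le0) (half_shuffleEw lef le1).
rewrite (half_shuffleEw lef le2) scaler_sumr -big_split; apply: eq_bigr => u _.
rewrite scaler_sumr -big_split; apply: eq_bigr => w _ /=.
by rewrite mcoeffD mcoeffZ mulrDr scalerDl scalerA mulrCA.
Qed.

Lemma half_shuffle1 w : 1 ≺ << w >> = 0.
Proof.
rewrite -(mpolyC1E {fmonom A} R) half_shuffleUU /half_shuffle_word fm1 /=.
by case: (size w).
Qed.

Lemma half_shufflee u : u != mone -> << u >> ≺ 1 = << u >>.
Proof.
rewrite -(mpolyC1E {fmonom A} R) half_shuffleUU /half_shuffle_word fm1 /=.
case: u => -[|a [|b u]] //=; first by rewrite -fmE => /negP[].
Qed.

Lemma half_shuffle_letter a w : letter a ≺ << w >> = letter a * << w >>.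
Proof.
rewrite /letter half_shuffleUU /half_shuffle_word /fmu fmE /=.
case: w => -[|b w] /=; last by rewrite /letter /fmu fmE.
by rewrite -[FMonom [::]]fmE -/(@malgC {fmonom A} R 1) mpolyC1E mulr1.
Qed.

Lemma half_shuffle_cons a u w : u != mone ->
  (letter a * << u >>) ≺ << w >> =
  letter a * (<< u >> ≺ << w >> + << w >> ≺ << u >>).
Proof.
rewrite letter_mulU !half_shuffleUU /half_shuffle_word (addnC (size w)).
case: u => -[|b u] /=; first by rewrite -fmE => /negP[].
case: w => -[|c w] _ //=.
by rewrite addr0; case: u => [|d u]; rewrite letter_mulU.
Qed.

End HalfShuffle.

Notation "f ≺ g" := (half_shuffle f g) : ring_scope.
Notation "f ⧢ g" := (shuffle f g) : ring_scope.

(* Main.v *)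
(* The half shuffle is a Zinbiel product, (f ≺ g) ≺ h = f ≺ (g ⧢ h), and this
   holds even when the arguments have constant terms.  Because (a f) ≺ g =
   a (f ⧢ g) for a letter a, the Zinbiel identity for (a u', v, w) amounts to
   associativity of ⧢ at (u', v, w), which in turn follows from Zinbiel
   identities on words of smaller total length.  With it, both sides of the
   statement become 3 (h ≺ (f ⧢ g) - f ≺ (g ⧢ h) - g ≺ (f ⧢ h)). *)
Require Import Defs.
From HB Require Import structures.
From mathcomp Require Import all_boot all_order all_algebra.
From mathcomp Require Import monalg reals.

Import GRing.Theory.

Local Open Scope ring_scope.

Section Zinbiel.

Variables (R : comNzRingType) (A : finType).
Implicit Types (a : A) (u v w : {fmonom A}) (f g h : tensor_alg R A).

Lemma tensor_ind (P : tensor_alg R A -> Prop) :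
  P 0 -> (forall c f g, P f -> P g -> P (c *: f + g)) ->
  (forall u, P << u >>) -> forall f, P f.
Proof.
move=> P0 PL PU f; rewrite (monalgE f).
elim/big_rec: _ => // u g _ Pg.
have -> : << f@_u *g u >> = f@_u *: << u >> :> tensor_alg R A.
  by rewrite -mul_malgC malgM_def fgmulUU mulr1 mul1m.
exact: PL.
Qed.

(** The size equation feeds the induction on total length in [half_shuffle_wordA]. *)
Lemma fmonomU_case u :
  << u >> = 1 :> tensor_alg R A \/
  exists a v, size u = (size v).+1 /\ << u >> = letter R a * << v >>.
Proof.
case: u => -[|a s]; first by left; rewrite -fmoneE -(mpolyC1E {fmonom A} R).
by right; exists a, (FMonom s); rewrite letter_mulU.
Qed.

(** * Bilinearity of both products *)

Lemma half_shuffle_bilinear :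
  bilinear_for *:%R *:%R (@half_shuffle R A).
Proof.
split=> [g c f1 f2|f c g1 g2]; first exact: half_shuffle_linearl.
exact: half_shuffle_linearr.
Qed.

#[local] HB.instance Definition _ :=
  bilinear_isBilinear.Build R _ _ _ _ _ (@half_shuffle R A)
    half_shuffle_bilinear.

Lemma addr_scaleD (V : lmodType R) (c r s : R) (x1 x2 y1 y2 z : V) :
  (c *: x1 + x2) + (c *: y1 + y2) + (c * r + s) *: z =
  c *: (x1 + y1 + r *: z) + (x2 + y2 + s *: z).
Proof.
rewrite scalerDl -scalerA !scalerDr [RHS]addrACA.
by congr (_ + _); apply: addrACA.
Qed.

Lemma shuffle_linearl c f1 f2 g :
  (c *: f1 + f2) ⧢ g = c *: (f1 ⧢ g) + f2 ⧢ g.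
Proof.
rewrite /shuffle half_shuffle_linearl half_shuffle_linearr mcoeffD mcoeffZ.
rewrite mulrDl -mulrA; exact: addr_scaleD.
Qed.

Lemma shuffleC f g : f ⧢ g = g ⧢ f.
Proof. by rewrite /shuffle (addrC (f ≺ g)) (mulrC f@_mone). Qed.

Lemma shuffleE f g : f ⧢ g = f ≺ g + g ≺ f + (f@_mone * g@_mone) *: 1.
Proof. by []. Qed.

(* Otherwise failing unifications unfold both products down to finite maps. *)
Opaque half_shuffle shuffle.

Lemma shuffle_mcoeff0 f g : f@_mone = 0 -> f ⧢ g = f ≺ g + g ≺ f.
Proof.
by move=> f0; rewrite shuffleE f0 (mul0r g@_mone) (scale0r 1) addr0.
Qed.

Lemma shuffle_linearr c f g1 g2 :
  f ⧢ (c *: g1 + g2) = c *: (f ⧢ g1) + f ⧢ g2.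
Proof. by rewrite !(shuffleC f) shuffle_linearl. Qed.

Lemma shuffle_bilinear : bilinear_for *:%R *:%R (@shuffle R A).
Proof.
split=> [g c f1 f2|f c g1 g2]; first exact: shuffle_linearl.
exact: shuffle_linearr.
Qed.

#[local] HB.instance Definition _ :=
  bilinear_isBilinear.Build R _ _ _ _ _ (@shuffle R A) shuffle_bilinear.

Lemma half_shuffle0l g : 0 ≺ g = 0. Proof. exact: linear0l. Qed.
Lemma half_shuffle0r f : f ≺ 0 = 0. Proof. exact: linear0r. Qed.
Lemma half_shuffleDl f1 f2 g : (f1 + f2) ≺ g = f1 ≺ g + f2 ≺ g.
Proof. exact: linearDl. Qed.
Lemma half_shuffleBl f1 f2 g : (f1 - f2) ≺ g = f1 ≺ g - f2 ≺ g.
Proof. exact: linearBl. Qed.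
Lemma shuffle0l g : 0 ⧢ g = 0. Proof. exact: linear0l. Qed.
Lemma shuffle0r f : f ⧢ 0 = 0. Proof. exact: linear0r. Qed.

(** * Units, letters and constant terms *)

Lemma half_shuffle1f f : 1 ≺ f = 0.
Proof.
elim/tensor_ind: f => [|c f g IHf IHg|u].
- exact: half_shuffle0r.
- by rewrite half_shuffle_linearr IHf IHg scaler0 addr0.
exact: half_shuffle1.
Qed.

(** Non-empty words are fixed and the empty word is killed, so only the constant term is lost. *)
Lemma half_shufflef1 f : f ≺ 1 = f - f@_mone *: 1.
Proof.
elim/tensor_ind: f => [|c f g IHf IHg|u].
- by rewrite half_shuffle0l mcoeff0 scale0r subr0.
- rewrite half_shuffle_linearl IHf IHg mcoeffD (mcoeffZ c f).
  by rewrite scalerDl -scalerA scalerBr addrACA opprD.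
have [->|u1] := eqVneq u mone.
  rewrite (mpolyC1E {fmonom A} R) half_shuffle1f mcoeff1 eqxx scale1r.
  by rewrite subrr.
by rewrite half_shufflee // mcoeffU1 (negPf u1) scale0r subr0.
Qed.

Lemma shuffle1f f : 1 ⧢ f = f.
Proof.
rewrite shuffleE half_shuffle1f half_shufflef1 add0r mcoeff1 eqxx mul1r.
exact: subrK.
Qed.

Lemma letter_mul_linear a c f g :
  letter R a * (c *: f + g) = c *: (letter R a * f) + letter R a * g.
Proof.
(* Letters need not commute with each other, but a constant is a multiple of the empty word and
   commutes with all of them. *)
have letterC : letter R a * c%:MP = c%:MP * letter R a.
  by rewrite !malgM_def !fgmulUU mulr1 mul1r mulm1 mul1m.
by rewrite mulrDr -[c *: f]mul_malgC mulrA letterC -mulrA mul_malgC.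
Qed.

(** Merges the two recursive equations: on the empty word, [1] is the unit of [⧢]; on any other
    word, the constant term of [⧢] vanishes. *)
Lemma half_shuffle_letter_mul a f g :
  (letter R a * f) ≺ g = letter R a * (f ⧢ g).
Proof.
elim/tensor_ind: f => [|c f1 f2 IH1 IH2|u].
- by rewrite mulr0 half_shuffle0l shuffle0l mulr0.
- by rewrite letter_mul_linear half_shuffle_linearl IH1 IH2 shuffle_linearl
    letter_mul_linear.
elim/tensor_ind: g => [|c g1 g2 IH1 IH2|w].
- by rewrite half_shuffle0r shuffle0r mulr0.
- by rewrite half_shuffle_linearr IH1 IH2 shuffle_linearr letter_mul_linear.
have [->|u1] := eqVneq u mone.
  by rewrite (mpolyC1E {fmonom A} R) mulr1 shuffle1f half_shuffle_letter.
rewrite (half_shuffle_cons R a w u1) shuffle_mcoeff0;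
  [by []|by rewrite mcoeffU1 (negPf u1)].
Qed.

Lemma mcoeff_half_shuffle1 f g : (f ≺ g)@_mone = 0.
Proof.
elim/tensor_ind: f => [|c f1 f2 IH1 IH2|u].
- by rewrite half_shuffle0l mcoeff0.
- by rewrite half_shuffle_linearl mcoeffD mcoeffZ IH1 IH2 mulr0 addr0.
have [->|[a [v [_ ->]]]] := fmonomU_case u.
  by rewrite half_shuffle1f mcoeff0.
(* Taking the constant term is multiplicative, and a letter has constant term zero. *)
by rewrite half_shuffle_letter_mul rmorphM /= mcoeffU1 fm1_eq1 mul0r.
Qed.

Lemma mcoeff_shuffle1 f g : (f ⧢ g)@_mone = f@_mone * g@_mone.
Proof.
rewrite shuffleE mcoeffD (mcoeffD _ (f ≺ g)) !mcoeff_half_shuffle1.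
by rewrite mcoeffZ mcoeff1 eqxx mulr1 !add0r.
Qed.

(** * Zinbiel identity and associativity *)

Lemma half_shuffle_shufflel f g h :
  (f ⧢ g) ≺ h = (f ≺ g) ≺ h + (g ≺ f) ≺ h.
Proof.
(* The constant part of [f ⧢ g] is a multiple of [1], which [≺] annihilates on the left. *)
rewrite (shuffleE f) addrC half_shuffle_linearl half_shuffle1f scaler0 add0r.
exact: half_shuffleDl.
Qed.

(** Both sides expand to [f ≺ (g ⧢ h)], [g ≺ (f ⧢ h)], [h ≺ (f ⧢ g)] and the same constant term. *)
Lemma shuffleA_half_shuffleA f g h :
  (f ≺ g) ≺ h = f ≺ (g ⧢ h) -> (g ≺ f) ≺ h = g ≺ (f ⧢ h) ->
  (g ≺ h) ≺ f = g ≺ (f ⧢ h) -> (h ≺ g) ≺ f = h ≺ (f ⧢ g) ->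
  f ⧢ g ⧢ h = f ⧢ (g ⧢ h).
Proof.
move=> fgh gfh ghf hgf.
rewrite (shuffleE (f ⧢ g)) (half_shuffle_shufflel f) fgh gfh mcoeff_shuffle1.
rewrite (shuffleE f (g ⧢ h)) (half_shuffle_shufflel g) ghf hgf mcoeff_shuffle1.
rewrite mulrA; congr (_ + _); exact/esym/addrA.
Qed.

Lemma half_shuffle_letter_mulA a f g h :
  f ⧢ g ⧢ h = f ⧢ (g ⧢ h) ->
  ((letter R a * f) ≺ g) ≺ h = (letter R a * f) ≺ (g ⧢ h).
Proof.
move=> fgh; rewrite [RHS]half_shuffle_letter_mul -fgh.
by rewrite (half_shuffle_letter_mul a f g) [LHS]half_shuffle_letter_mul.
Qed.

Lemma half_shuffle_wordA n u v w : (size u + size v + size w < n)%N ->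
  (<< u >> ≺ << v >>) ≺ << w >> =
    << u >> ≺ (<< v >> ⧢ << w >>) :> tensor_alg R A.
Proof.
elim: n u v w => [|n IHn] u v w; first by rewrite ltn0 => /notF[].
have [->|[a [u' [-> ->]]]] := fmonomU_case u.
  by rewrite !half_shuffle1f half_shuffle0l.
rewrite addSn addSn ltnS => lt_n.
(* The four instances needed permute [u'], [v] and [w], which is why [n] bounds the total length and
   not that of [u] alone. *)
apply: half_shuffle_letter_mulA; apply: shuffleA_half_shuffleA.
- exact: IHn.
- by rewrite IHn // (addnC (size v)).
- by rewrite (shuffleC << u' >>) IHn // addnAC (addnC (size v)).
by rewrite (shuffleC << u' >>) IHn // -addnA addnC (addnC (size v)).
Qed.

Lemma half_shuffleA f g h : (f ≺ g) ≺ h = f ≺ (g ⧢ h).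
Proof.
elim/tensor_ind: f => [|c f1 f2 IH1 IH2|u].
- by rewrite !half_shuffle0l.
- by rewrite !half_shuffle_linearl IH1 IH2.
elim/tensor_ind: g => [|c g1 g2 IH1 IH2|v].
- by rewrite half_shuffle0r shuffle0l half_shuffle0l half_shuffle0r.
- by rewrite half_shuffle_linearr half_shuffle_linearl shuffle_linearl
    half_shuffle_linearr IH1 IH2.
elim/tensor_ind: h => [|c h1 h2 IH1 IH2|w].
- by rewrite shuffle0r !half_shuffle0r.
- by rewrite shuffle_linearr !half_shuffle_linearr IH1 IH2.
exact: half_shuffle_wordA (ltnSn _).
Qed.

(** Interleavings are sorted by the factor that supplies the first letter; the last term is the case
    of three empty words. *)
Lemma shuffleEA f g h : f ⧢ g ⧢ h =
  h ≺ (f ⧢ g) + f ≺ (g ⧢ h) + g ≺ (f ⧢ h) + (f@_mone * g@_mone * h@_mone) *: 1.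
Proof.
rewrite (shuffleE (f ⧢ g)) (half_shuffle_shufflel f).
rewrite (half_shuffleA f g) (half_shuffleA g f) mcoeff_shuffle1.
by rewrite [X in X + _ = _]addrC [X in X + _ = _]addrA.
Qed.

(** * Area identities *)

Lemma mcoeff_area1 f g : (area f g)@_mone = 0.
Proof. by rewrite /area mcoeffB !mcoeff_half_shuffle1 subrr. Qed.

Lemma area_half_shuffle f g h :
  (area h g) ≺ f = h ≺ (f ⧢ g) - g ≺ (f ⧢ h).
Proof. by rewrite /area half_shuffleBl !half_shuffleA !(shuffleC f). Qed.

(** As [area h g] has no constant term, the terms [f ≺ area h g] cancel and [area h g ≺ f] remains
    twice. *)
Lemma shuffleD_area f g h : f ⧢ area h g + area (area h g) f =
  (h ≺ (f ⧢ g) - g ≺ (f ⧢ h)) *+ 2.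
Proof.
rewrite -(area_half_shuffle f g h); move: (mcoeff_area1 h g).
move: (area h g) => k k0; rewrite shuffleC (shuffle_mcoeff0 k f k0) /area.
by rewrite addrACA subrr addr0.
Qed.

Lemma area_shuffle f g h :
  area h (f ⧢ g) = h ≺ (f ⧢ g) - (f ≺ (g ⧢ h) + g ≺ (f ⧢ h)).
Proof.
rewrite /area (half_shuffle_shufflel f g h).
by rewrite (half_shuffleA f g h) (half_shuffleA g f h).
Qed.

End Zinbiel.

Lemma mulr3nB (V : zmodType) (x y z p p' q q' : V) :
  p + p' = (x - z) *+ 2 -> q + q' = (x - y) *+ 2 ->
  (x - (y + z)) *+ 3 = p + q - (x + y + z) + p' + q'.
Proof.
move=> pp qq.
(* Three forms of [x - (y + z)], one per copy in the triple; they add up to twice [x - z], plus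
   twice [x - y], minus [x + y + z]. *)
have xz_y : x - z - y = x - (y + z) by rewrite opprD addrAC addrA.
have xy_z : x - y - z = x - (y + z) by rewrite opprD addrA.
have xzxy_x : x - z + (x - y) - x = x - (y + z).
  by rewrite addrAC [x - z - x]addrAC subrr add0r addrC.
rewrite [RHS](AC 5 ((1*4)*(2*5)*3))%AC /= pp qq.
rewrite mulrSr mulr2n -{1}xz_y -{1}xy_z -xzxy_x !mulr2n !opprD.
move: (x - z) (x - y) => a b.
by rewrite (AC (2*2*3) ((1*5)*(3*6)*(7*2*4)))%AC.
Qed.

Theorem lemma3p11 (R : realType) (A : finType) (f g h : tensor_alg R A) :
  3%:R *: area h (f ⧢ g) =
    f ⧢ area h g + g ⧢ area h f - f ⧢ g ⧢ h
    + (f@_mone * g@_mone * h@_mone) *: 1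
    + area (area h g) f + area (area h f) g.
Proof.
(* The constant term of the triple shuffle cancels the explicit multiple of [1]. *)
rewrite shuffleEA opprD (addrA _ (- _)) subrK.
rewrite [LHS]scaler_nat area_shuffle; apply: mulr3nB.
  exact: shuffleD_area.
rewrite (shuffleC R A f g); exact: shuffleD_area.
Qed.
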